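(* Let $Q$ be a linear open type quadrature rule, $Q(\psi,0,1)=\sum_{j=0}^{m}B_j\,\psi(x_j)$ with $0<x_0<x_1<\dots<x_m<1$ and $\sum_{j=0}^m B_j=1$, and define $$D_Q=\frac{Q(x^{-1},0,1)}{\log(x_0^{-1})}.$$ Let $C_Q$ be the constant defined in the context. If $$\tilde A(\cdot,0,1)=\sum_{k=0}^{n-1}Q(\cdot,s_k,s_{k+1})$$ for some $0=s_0<s_1<\dots<s_n=1$ ($n\ge 1$), then $$\tilde A\Big(\frac1x,0,1\Big)\le \max\{C_Q,D_Q\}\,\log(x_{00}^{-1}),$$ where $x_{00}$ is the smallest node of $Q(\cdot,s_0,s_1)$.
   Context: The weights $B_j$ are real numbers. For an interval $[a,b]$, $Q(\psi,a,b)$ denotes the rule $Q$ transported linearly to $[a,b]$: $$Q(\psi,a,b)=(b-a)\sum_{j=0}^{m}B_j\,\psi\big(a+(b-a)x_j\big),$$ whose nodes are $a+(b-a)x_j$, $0\le j\le m$. Here $Q(\frac1x,a,b)$ (also written $Q(x^{-1},a,b)$) means $Q(\psi,a,b)$ with $\psi(x)=1/x$, and similarly for $\tilde A(\frac1x,0,1)$. ''Open type'' means $x_0>0$ and $x_m<1$. The constant $C_Q$ is $$C_Q=\sup_{0<a<b<1}\frac{Q(x^{-1},a,b)}{\int_a^b x^{-1}\,dx},$$ which is a finite positive number, so that $Q(\frac1x,a,b)\le C_Q\int_a^b\frac1x\,dx$ for all $0<a<b<1$. $\log$ is the natural logarithm. *)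

(* Defs.v *)
From HB Require Import structures.
From mathcomp Require Import all_boot all_order all_algebra.
From mathcomp Require Import all_classical all_reals all_analysis.
Set Implicit Arguments.
Unset Strict Implicit.
Unset Printing Implicit Defensive.
Import Order.TTheory GRing.Theory Num.Theory.
Import numFieldNormedType.Exports.
Local Open Scope classical_set_scope.
Local Open Scope ring_scope.

Definition quad_node (R : realType) (m : nat) (x : 'I_m.+1 -> R) (a b : R)
  (j : 'I_m.+1) : R := a + (b - a) * x j.

Definition quad (R : realType) (m : nat) (B x : 'I_m.+1 -> R)
  (psi : R -> R) (a b : R) : R :=
  (b - a) * \sum_(j < m.+1) B j * psi (quad_node x a b j).

Definition smallest_node (R : realType) (m : nat) (x : 'I_m.+1 -> R)
  (a b : R) : R :=
  \big[Num.min/quad_node x a b ord0]_(j < m.+1) quad_node x a b j.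

Definition open_quad_rule (R : realType) (m : nat) (B x : 'I_m.+1 -> R) :
  Prop :=
  [/\ 0 < x ord0,
      forall i j : 'I_m.+1, (i < j)%N -> x i < x j,
      x ord_max < 1
    & \sum_(j < m.+1) B j = 1].

Definition composite_quad (R : realType) (m : nat) (B x : 'I_m.+1 -> R)
  (n : nat) (s : 'I_n.+1 -> R) (psi : R -> R) : R :=
  \sum_(k < n) quad B x psi (s (widen_ord (leqnSn n) k)) (s (lift ord0 k)).

(* [sup] is the real-valued supremum, equal to 0 by convention on sets without
   one; for an open rule this set of ratios is nonempty and bounded above:
   since ln (b / a) >= (b - a) / b, each ratio is at most
   \sum_j `|B j| / x j. *)
Definition C_Q (R : realType) (m : nat) (B x : 'I_m.+1 -> R) : R :=
  sup [set r : R | exists a b : R, [/\ 0 < a, a < b, b < 1 &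
    r = quad B x (fun t => t^-1) a b /
        (\int[lebesgue_measure]_(t in `[a, b]) t^-1)]].

Definition D_Q (R : realType) (m : nat) (B x : 'I_m.+1 -> R) : R :=
  quad B x (fun t => t^-1) 0 1 / ln (x ord0)^-1.

(* Main.v *)
Require Import Defs.
From HB Require Import structures.
From mathcomp Require Import all_boot all_order all_algebra.
From mathcomp Require Import all_classical all_reals all_analysis.
Set Implicit Arguments.
Unset Strict Implicit.
Unset Printing Implicit Defensive.
Import Order.TTheory GRing.Theory Num.Theory.
Import numFieldNormedType.Exports.
Local Open Scope classical_set_scope.
Local Open Scope ring_scope.

(** The reciprocal function is homogeneous of degree -1, so a transported rule
    applied to it does not change when the interval is dilated
    ([quad_inv_scale]), just as the integral of the reciprocal over [a, b]
    depends only on b / a.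

    Dilating the first panel [0, s_1] to [0, 1] shows that it contributes
    exactly D_Q log(1/x_0).  Each later panel [s_k, s_(k+1)] stays away from 0
    and contributes at most C_Q log(s_(k+1)/s_k) ([quad_inv_le_C_Q]); these
    logarithms telescope to log(1/s_1).  Both log(1/x_0) and log(1/s_1) are
    nonnegative, so both constants may be replaced by their maximum, and
    log(1/x_0) + log(1/s_1) = log(1/x_00) because the smallest node of the
    first panel is s_1 x_0.

    Two points need care in the bound by C_Q.  The real supremum dominates the
    ratios only once these are known to be bounded ([quad_inv_ratio_le]).  And
    the supremum runs over b < 1 only, whereas the last panel ends at 1: this
    too is settled by dilating, here into (0, 1). *)

Lemma quad_inv_scale (R : realType) (m : nat) (B x : 'I_m.+1 -> R) (c a b : R) :
  c != 0 ->
  quad B x (fun t => t^-1) (c * a) (c * b) = quad B x (fun t => t^-1) a b.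
Proof.
move=> c0; rewrite /quad -mulrBr.
have -> : \sum_(j < m.+1) B j * (quad_node x (c * a) (c * b) j)^-1 =
    c^-1 * \sum_(j < m.+1) B j * (quad_node x a b j)^-1.
  rewrite mulr_sumr; apply: eq_bigr => j _.
  by rewrite /quad_node -mulrBr -mulrA -mulrDr invfM mulrCA.
by rewrite mulrACA mulfV// mul1r.
Qed.

Lemma Rintegral_inv (R : realType) (a b : R) : 0 < a -> a < b ->
  \int[lebesgue_measure]_(t in `[a, b]) t^-1 = ln b - ln a.
Proof.
move=> a0 ab; rewrite /Rintegral.
rewrite (@continuous_FTC2 R (fun t => t^-1) (@ln R) a b ab)//.
- apply: continuous_in_subspaceT => t; rewrite inE/= in_itv/= => /andP[at' _].
  by apply: inv_continuous; rewrite gt_eqF// (lt_le_trans a0).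
- split.
  + move=> t; rewrite in_itv/= => /andP[at' _].
    by have := is_derive1_ln (lt_trans a0 at') => -[].
  + exact/cvg_at_right_filter/continuous_ln.
  + exact/cvg_at_left_filter/continuous_ln/(lt_trans a0).
- move=> t; rewrite in_itv/= => /andP[at' _].
  rewrite derive1E; have := is_derive1_ln (lt_trans a0 at').
  by move=> ?; rewrite derive_val.
Qed.

Lemma subr_div_le_ln (R : realType) (a b : R) : 0 < a -> a < b ->
  (b - a) / b <= ln b - ln a.
Proof.
move=> a0 ab; have b0 := lt_trans a0 ab.
rewrite -lerN2 opprB -ln_div ?posrE// mulrBl mulfV ?gt_eqF// opprB.
have := @le_ln1Dx R (a / b - 1).
rewrite [1 + _]addrC subrK; apply.
by rewrite ltrBrDr addrC subrr divr_gt0.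
Qed.

Lemma open_quad_rule_node (R : realType) (m : nat) (B x : 'I_m.+1 -> R)
    (hQ : open_quad_rule B x) (j : 'I_m.+1) :
  x ord0 <= x j /\ 0 < x j < 1.
Proof.
case: hQ => x0 xs x1 _.
have x0j : x ord0 <= x j.
  have [->//|j0] := eqVneq j ord0.
  by rewrite ltW// xs// lt0n; apply: contra j0 => /eqP ?; exact/eqP/val_inj.
split=> //; rewrite (lt_le_trans x0 x0j)/=.
apply: le_lt_trans x1; have [->//|jm] := eqVneq j ord_max.
rewrite ltW// xs//= ltn_neqAle -ltnS ltn_ord andbT.
by apply: contra jm => /eqP ?; exact/eqP/val_inj.
Qed.

(** Each node of [a, b] is at least b * x j, so the rule is at most
    ((b - a) / b) * \sum_j `|B j| / x j, and (b - a) / b <= log (b / a). *)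
Lemma quad_inv_ratio_le (R : realType) (m : nat) (B x : 'I_m.+1 -> R) (a b : R) :
  open_quad_rule B x -> 0 < a -> a < b ->
  quad B x (fun t => t^-1) a b / (ln b - ln a) <= \sum_(j < m.+1) `|B j| / x j.
Proof.
move=> hQ a0 ab; have b0 := lt_trans a0 ab.
have l0 : 0 < ln b - ln a by rewrite subr_gt0 ltr_ln ?posrE.
have S0 : 0 <= \sum_(j < m.+1) `|B j| / x j.
  apply: sumr_ge0 => j _; have [_ /andP[xj0 _]] := open_quad_rule_node hQ j.
  by rewrite divr_ge0// ltW.
rewrite ler_pdivrMr//.
apply: (@le_trans _ _ ((b - a) / b * \sum_(j < m.+1) `|B j| / x j)); last first.
  by rewrite mulrC ler_wpM2l// subr_div_le_ln.
rewrite /quad -mulrA ler_wpM2l ?subr_ge0 ?(ltW ab)// mulr_sumr.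
apply: ler_sum => j _; have [_ /andP[xj0 xj1]] := open_quad_rule_node hQ j.
have bxj0 : 0 < b * x j by rewrite mulr_gt0.
have node_ge : b * x j <= quad_node x a b j.
  rewrite /quad_node mulrBl addrCA lerDl subr_ge0.
  by rewrite ler_piMr// ltW.
have node_gt0 := lt_le_trans bxj0 node_ge.
rewrite mulrCA -invfM (le_trans (ler_wpM2r _ (ler_norm _)))//.
  by rewrite invr_ge0 ltW.
by rewrite ler_wpM2l// lef_pV2.
Qed.

(** [C_Q] only ranges over intervals inside (0, 1), but both sides are invariant
    under dilation, which brings any interval with 0 < a there. *)
Lemma quad_inv_le_C_Q (R : realType) (m : nat) (B x : 'I_m.+1 -> R) (a b : R) :
  open_quad_rule B x -> 0 < a -> a < b ->
  quad B x (fun t => t^-1) a b <= C_Q B x * (ln b - ln a).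
Proof.
move=> hQ a0 ab; have b0 := lt_trans a0 ab.
(* The factor c sends b to 1/2, hence [a, b] into (0, 1). *)
pose c := (2 * b)^-1.
have c0 : 0 < c by rewrite invr_gt0 mulr_gt0.
have ca0 : 0 < c * a by rewrite mulr_gt0.
have cb0 : 0 < c * b by rewrite mulr_gt0.
have cab : c * a < c * b by rewrite ltr_pM2l.
have cb1 : c * b < 1.
  by rewrite /c invfM mulfVK ?gt_eqF// invf_lt1// ltr1n.
have lnc : ln (c * b) - ln (c * a) = ln b - ln a.
  by rewrite !lnM ?posrE// opprD addrACA subrr add0r.
rewrite -(@quad_inv_scale R m B x c a b) ?gt_eqF// -lnc.
rewrite -ler_pdivrMr ?subr_gt0 ?ltr_ln ?posrE//.
apply: ub_le_sup.
  exists (\sum_(j < m.+1) `|B j| / x j) => _ [u [v [u0 uv _ ->]]].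
  by rewrite Rintegral_inv// quad_inv_ratio_le.
by exists (c * a), (c * b); split => //; rewrite Rintegral_inv.
Qed.

Lemma quad_inv_0c (R : realType) (m : nat) (B x : 'I_m.+1 -> R) (c : R) :
  open_quad_rule B x -> 0 < c ->
  quad B x (fun t => t^-1) 0 c = D_Q B x * ln (x ord0)^-1.
Proof.
move=> hQ c0; rewrite -[in LHS](mulr0 c) -[X in quad _ _ _ _ X](mulr1 c).
rewrite quad_inv_scale ?gt_eqF// divfK// gt_eqF// ln_gt0//.
by have [_ /andP[x0 x1]] := open_quad_rule_node hQ ord0; rewrite invf_gt1.
Qed.

Lemma smallest_node_0c (R : realType) (m : nat) (B x : 'I_m.+1 -> R) (c : R) :
  open_quad_rule B x -> 0 < c -> smallest_node x 0 c = c * x ord0.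
Proof.
move=> hQ c0; have nodeE j : quad_node x 0 c j = c * x j.
  by rewrite /quad_node add0r subr0.
rewrite /smallest_node nodeE; apply: bigmin_eq_id => j _.
by rewrite nodeE ler_pM2l//; have [] := open_quad_rule_node hQ j.
Qed.

Theorem theorem1 (R : realType) (m : nat) (B x : 'I_m.+1 -> R)
  (hQ : open_quad_rule B x)
  (n : nat) (hn : (1 <= n)%N) (s : 'I_n.+1 -> R)
  (hs0 : s ord0 = 0) (hsn : s ord_max = 1)
  (hs : forall i j : 'I_n.+1, (i < j)%N -> s i < s j) :
  composite_quad B x s (fun t => t^-1)
    <= Num.max (C_Q B x) (D_Q B x)
       * ln (smallest_node x (s ord0) (s (inord 1)))^-1.
Proof.
case: n hn s hs0 hsn hs => // p _ s hs0 hsn hs.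
have s_gt0 k : (k <= p)%N -> 0 < s (inord k.+1).
  by move=> kp; rewrite -hs0; apply: hs; rewrite inordK.
have [x0_gt0 x0_lt1] : 0 < x ord0 /\ x ord0 < 1.
  by have [_ /andP[]] := open_quad_rule_node hQ ord0.
have s1_gt0 := s_gt0 0 isT.
have s_last : s (inord p.+1) = 1.
  by rewrite -hsn; congr s; apply: val_inj; rewrite /= inordK.
have s1_le1 : s (inord 1) <= 1.
  (* With a single panel, s_1 is the endpoint 1 itself. *)
  rewrite -s_last; case: (p) s {hs0 hsn s_gt0 s1_gt0 s_last} hs => // q s hs.
  by rewrite ltW// hs// !inordK.
have later_panels : \sum_(k < p) quad B x (fun t => t^-1)
      (s (inord k.+1)) (s (inord k.+2)) <= C_Q B x * ln (s (inord 1))^-1.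
  have -> : ln (s (inord 1))^-1 =
      \sum_(k < p) (ln (s (inord k.+2)) - ln (s (inord k.+1))).
    rewrite -(big_mkord xpredT
      (fun k => ln (s (inord k.+2)) - ln (s (inord k.+1)))).
    rewrite (telescope_sumr (fun k => ln (s (inord k.+1))))//.
    by rewrite s_last ln1 sub0r lnV.
  rewrite mulr_sumr; apply: ler_sum => k _.
  apply: quad_inv_le_C_Q => //; first by rewrite s_gt0// ltnW.
  by apply: hs; rewrite !inordK ?ltnS// ltnW.
have -> : composite_quad B x s (fun t => t^-1) =
    D_Q B x * ln (x ord0)^-1 +
    \sum_(k < p) quad B x (fun t => t^-1) (s (inord k.+1)) (s (inord k.+2)).
  rewrite /composite_quad big_ord_recl; congr (_ + _).
    rewrite -(quad_inv_0c hQ s1_gt0) -hs0; congr (quad _ _ _ (s _) (s _));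
      by apply: val_inj; rewrite /= ?inordK.
  apply: eq_bigr => k _; congr (quad _ _ _ (s _) (s _));
    by apply: val_inj; rewrite /= inordK// ?ltnS// ltnW.
rewrite hs0 (smallest_node_0c hQ s1_gt0) invfM lnM ?posrE ?invr_gt0//.
rewrite mulrDr addrC lerD//.
- apply: le_trans later_panels _; apply: ler_wpM2r; last by rewrite le_max lexx.
  by rewrite ln_ge0// invf_ge1.
- apply: ler_wpM2r; last by rewrite le_max lexx orbT.
  by rewrite ln_ge0// invf_ge1// ltW.
Qed.
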